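(* Let $\mathcal{S}$ be a dilation invariant finite system of equations. Then $\mathcal{S}$ is partition regular if and only if, for every multiplicatively syndetic set $S\subseteq\mathbb{N}$, $\mathcal{S}$ has a non-trivial solution all of whose entries lie in $S$.
   Context: $\mathbb{N}=\{1,2,3,\dots\}$. A finite system of equations $\mathcal{S}$ in $s$ variables consists of finitely many equations $p_i(t_1,\dots,t_s)=0$ ($1\le i\le k$) with $p_i\in\mathbb{Q}[t_1,\dots,t_s]$. A solution is a tuple $\mathbf{x}=(x_1,\dots,x_s)\in\mathbb{N}^s$ with $p_i(\mathbf{x})=0$ for all $i$; it is non-trivial if $x_i\neq x_j$ for some $i\neq j$. $\mathcal{S}$ is dilation invariant if whenever $\mathbf{x}$ is a solution, $\lambda\mathbf{x}=(\lambda x_1,\dots,\lambda x_s)$ also satisfies all the equations for every $\lambda\in\mathbb{Q}$. $\mathcal{S}$ is partition regular if for every $r\in\mathbb{N}$ and every colouring $\mathbb{N}=C_1\cup\dots\cup C_r$ there is a non-trivial solution with all entries in a single colour class $C_k$. For a non-empty finite set $F\subset\mathbb{N}$, a set $S\subseteq\mathbb{N}$ is multiplicatively $F$-syndetic if for every $n\in\mathbb{N}$ there exists $t\in F$ with $nt\in S$; $S$ is multiplicatively syndetic if it is multiplicatively $F$-syndetic for some non-empty finite $F\subset\mathbb{N}$. *)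

(* Defs.v *)
From mathcomp Require Import all_boot all_order all_algebra.
From mathcomp Require Import finmap mpoly.

Set Implicit Arguments.
Unset Strict Implicit.
Unset Printing Implicit Defensive.

Import Order.TTheory GRing.Theory Num.Theory.
Local Open Scope ring_scope.

(* The positive integers N = {1, 2, 3, ...} are the n : nat with 0 < n. *)

Definition subset_N (A : nat -> Prop) : Prop := forall n, A n -> (0 < n)%N.

Definition eqn_system (s : nat) := seq {mpoly rat[s]}.

Definition satisfies (s : nat) (E : eqn_system s) (y : 'I_s -> rat) : Prop :=
  forall p, p \in E -> p.@[y] = 0.

Definition solution (s : nat) (E : eqn_system s) (x : 'I_s -> nat) : Prop :=
  (forall i, (0 < x i)%N) /\ satisfies E (fun i => (x i)%:R).

Definition nontrivial (s : nat) (x : 'I_s -> nat) : Prop :=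
  exists i j : 'I_s, i <> j /\ x i <> x j.

Definition dilation_invariant (s : nat) (E : eqn_system s) : Prop :=
  forall x : 'I_s -> nat, solution E x ->
  forall lambda : rat, satisfies E (fun i => lambda * (x i)%:R).

Definition has_nontrivial_solution_in (s : nat) (E : eqn_system s)
    (A : nat -> Prop) : Prop :=
  exists x : 'I_s -> nat,
    [/\ solution E x, nontrivial x & forall i, A (x i)].

(* The colour classes need not be disjoint. *)
Definition colouring (r : nat) (C : 'I_r -> nat -> Prop) : Prop :=
  (forall k, subset_N (C k)) /\ (forall n, (0 < n)%N -> exists k, C k n).

Definition partition_regular (s : nat) (E : eqn_system s) : Prop :=
  forall r : nat, (0 < r)%N ->
  forall C : 'I_r -> nat -> Prop, colouring C ->
  exists k : 'I_r, has_nontrivial_solution_in E (C k).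

Definition mul_F_syndetic (F : {fset nat}) (A : nat -> Prop) : Prop :=
  forall n, (0 < n)%N -> exists2 t, t \in F & A (n * t)%N.

Definition mul_syndetic (A : nat -> Prop) : Prop :=
  exists F : {fset nat},
    [/\ F <> fset0, (forall t, t \in F -> (0 < t)%N) & mul_F_syndetic F A].

(* Main.v *)
Require Import Defs.
From mathcomp Require Import all_boot all_order all_algebra.
From mathcomp Require Import finmap mpoly.
From Stdlib Require Import Classical ClassicalEpsilon.

(** If [A] is [F]-syndetic, the sets [{n | n t \in A}] for [t] in [F] cover the
    positive integers, and dilating a monochromatic solution by [t] moves it
    into [A].

    Conversely, induct on the number of colours. Either some colour class is
    syndetic, or it misses a dilate of [{1, ..., N}] for every [N]. Pulling the
    colouring back along these dilations and passing to a pointwise limit along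
    a subsequence gives a colouring that avoids this colour; any finite piece of
    it is a dilate of a piece of the original one, so dilation invariance
    transports its monochromatic solutions back. *)

Import GRing.Theory.

Set Implicit Arguments.
Unset Strict Implicit.
Unset Printing Implicit Defensive.

Definition unbounded (P : nat -> Prop) : Prop :=
  forall M, exists2 N, (M <= N)%N & P N.

Lemma unbounded_pigeonhole (T : finType) (P : nat -> Prop) (g : nat -> T) :
  unbounded P -> exists v, unbounded (fun N => P N /\ g N = v).
Proof.
move=> infP; apply: NNPP => noV.
have bnd v : exists M, forall N, (M <= N)%N -> P N -> g N <> v.
  apply: NNPP => noM; apply: noV; exists v => M.
  apply: NNPP => noN; apply: noM; exists M => N leMN PN gN.
  by apply: noN; exists N.
have [m mP] := fin_all_exists bnd.
have [N leN PN] := infP (\max_v m v).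
by apply: (mP (g N) N) => //; apply: leq_trans leN; apply: leq_bigmax.
Qed.

(** Sequential compactness of the space of [T]-valued sequences: the values of [d] are fixed one
    coordinate at a time by pigeonhole. *)
Lemma pointwise_cluster_point (T : finType) (f : nat -> nat -> T) :
  exists d : nat -> T,
    forall M, exists2 N, (M <= N)%N & forall t, (t < M)%N -> f N t = d t.
Proof.
have inhT : inhabited T by constructor; exact: (f 0 0).
pose pick (Q : nat -> Prop) t :=
  epsilon inhT (fun v => unbounded (fun N => Q N /\ f N t = v)).
(* [Q t] keeps the indices [N] for which [f N] takes the picked values at all coordinates below [t];
   each pick keeps this set unbounded. *)
pose fix Q t := if t is u.+1 then fun N => Q u N /\ f N u = pick (Q u) u
                else fun=> True.
have infQ t : unbounded (Q t).
  elim: t => [|t IHt]; first by move=> M; exists M.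
  exact: (epsilon_spec inhT _ (unbounded_pigeonhole (f^~ t) IHt)).
have agree t N : Q t N -> forall u, (u < t)%N -> f N u = pick (Q u) u.
  elim: t => [|t IHt] //= [QN ft] u; rewrite ltnS leq_eqVlt.
  by case/orP=> [/eqP-> //|]; apply: IHt.
exists (fun t => pick (Q t) t) => M; have [N leMN QN] := infQ M M.
by exists N => //; apply: agree.
Qed.

Lemma satisfies_ext (s : nat) (E : eqn_system s) (y z : 'I_s -> rat) :
  y =1 z -> satisfies E y -> satisfies E z.
Proof.
move=> eq_yz Ey p pE; rewrite -(Ey p pE) !mevalE.
by apply: eq_bigr => m _; congr (_ * _)%R; apply: eq_bigr => i _; rewrite eq_yz.
Qed.

Lemma dilate_nontrivial_solution (s : nat) (E : eqn_system s)
    (A : nat -> Prop) (x : 'I_s -> nat) (n : nat) :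
  dilation_invariant E -> (0 < n)%N -> solution E x -> nontrivial x ->
  (forall i, A (n * x i)%N) -> has_nontrivial_solution_in E A.
Proof.
move=> hE n_gt0 solx [i [j [neq_ij neq_x]]] Ax.
have [x_gt0 _] := solx.
exists (fun i => n * x i)%N; split=> //.
  split=> [k|]; first by rewrite muln_gt0 n_gt0 x_gt0.
  by apply: satisfies_ext (hE x solx n%:R%R) => k; rewrite natrM.
exists i, j; split=> // /eqP; rewrite eqn_pmul2l // => /eqP; exact: neq_x.
Qed.

Lemma not_syndetic_avoids_dilate (A : nat -> Prop) :
  ~ mul_syndetic A ->
  forall N, exists2 n, (0 < n)%N &
    forall t, (0 < t)%N -> (t <= N)%N -> ~ A (n * t)%N.
Proof.
move=> nsA N; apply: NNPP => no_n; apply: nsA.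
(* The set is [{1, ..., N+1}], so that it is non-empty even for [N = 0]. *)
exists [fset t in iota 1 N.+1]%fset.
have memF t : (t \in [fset t in iota 1 N.+1]%fset) = (0 < t < N.+2)%N.
  by rewrite in_fset mem_iota add1n.
split=> [F0|t|n n_gt0]; first by have := memF 1; rewrite F0 in_fset0.
  by rewrite memF => /andP[].
apply: NNPP => no_t; apply: no_n; exists n => // t t_gt0 leN Ant.
by apply: no_t; exists t => //; rewrite memF t_gt0 ltnS leqW.
Qed.

(** The set [J] of allowed colours carries the induction: it shrinks while [T] stays fixed, so
    colours are never renumbered. *)
Lemma monochromatic_solution (s : nat) (E : eqn_system s) (T : finType) :
  dilation_invariant E ->
  (forall A : nat -> Prop, subset_N A -> mul_syndetic A ->
     has_nontrivial_solution_in E A) ->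
  forall (J : {set T}) (c : nat -> T),
    (forall n, (0 < n)%N -> c n \in J) ->
    exists k, has_nontrivial_solution_in E (fun n => (0 < n)%N /\ c n = k).
Proof.
move=> hE solA J; have [m] := ubnP #|J|; elim: m J => // m IHm J leJm c cJ.
(* A colour that occurs lies in [J], so removing it lowers the cardinal. *)
pose k := c 1; pose A n := (0 < n)%N /\ c n = k.
have [synA|nsynA] := classic (mul_syndetic A).
  by exists k; apply: solA => // n [].
have [nu nuP] : exists nu : nat -> nat, forall N, (0 < nu N)%N /\
    forall t, (0 < t)%N -> (t <= N)%N -> c (nu N * t)%N <> k.
  have av N : exists n, (0 < n)%N /\
      forall t, (0 < t)%N -> (t <= N)%N -> c (n * t)%N <> k.
    have [n n_gt0 nP] := not_syndetic_avoids_dilate nsynA N.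
    exists n; split=> // t t_gt0 letN cnt; apply: (nP t) => //.
    by split=> //; rewrite muln_gt0 n_gt0.
  exists (fun N => sval (constructive_indefinite_description _ (av N))) => N.
  exact: svalP (constructive_indefinite_description _ (av N)).
have [d dP] := pointwise_cluster_point (fun N t => c (nu N * t)%N).
have dJ t : (0 < t)%N -> d t \in J :\ k.
  (* Agreement below [t.+1] covers [t], and [t < N] puts [t] in the range where the dilate by [nu N]
     avoids [k]. *)
  move=> t_gt0; have [N ltN <- //] := dP t.+1.
  have [nu_gt0 nuN] := nuP N.
  by rewrite !inE cJ ?muln_gt0 ?nu_gt0 // andbT; apply/eqP/nuN => //; apply: ltnW.
have ltJ : (#|J :\ k| < m)%N.
  by move: leJm; rewrite (cardsD1 k) cJ.
have [l [x [solx ntx xl]]] := IHm _ ltJ d dJ.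
(* Agreement is strict, hence one more than the largest entry of [x]. *)
have [N _ dN] := dP (\max_i x i).+1.
have [nu_gt0 _] := nuP N.
exists l; apply: (dilate_nontrivial_solution (n := nu N) (x := x)) => // i.
have [xi_gt0 dxi] := xl i.
rewrite muln_gt0 nu_gt0 xi_gt0; split=> //; rewrite dN //.
by rewrite ltnS; apply: leq_bigmax.
Qed.

Theorem theorem1p1 (s : nat) (E : eqn_system s) (hE : dilation_invariant E) :
  partition_regular E <->
  (forall A : nat -> Prop, subset_N A -> mul_syndetic A ->
     has_nontrivial_solution_in E A).
Proof.
split=> [prE A _ [F [F0 F_gt0 synA]] | solA r r_gt0 C [C_pos C_cov]].
  have F_card : (0 < #|` F|)%N by rewrite cardfs_gt0; apply/eqP.
  (* Colours are positions in [F]; these classes may overlap. *)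
  pose C (k : 'I_#|` F|) n := (0 < n)%N /\ A (n * nth 0 F k)%N.
  have [|k [x [solx ntx xC]]] := prE _ F_card C.
    split=> [k n []//|n n_gt0]; have [t tF Ant] := synA n n_gt0.
    have lt_t : (index t F < #|` F|)%N by rewrite index_mem.
    by exists (Ordinal lt_t); split=> //=; rewrite nth_index.
  apply: (dilate_nontrivial_solution (n := nth 0 F k) (x := x)) => // [|i].
    exact: F_gt0 (mem_nth 0 (ltn_ord k)).
  by have [_] := xC i; rewrite mulnC.
have inhr : inhabited 'I_r by constructor; exact: Ordinal r_gt0.
(* Overlapping classes are made into a function by choosing one class for each [n]; the value at [0]
   is arbitrary. *)
pose c n := epsilon inhr (fun k => C k n).
have cP n : (0 < n)%N -> C (c n) n.
  by move=> n_gt0; apply: (epsilon_spec inhr _ (C_cov n n_gt0)).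
have [//|k [x [solx ntx xk]]] :=
  @monochromatic_solution s E 'I_r hE solA [set: 'I_r] c.
exists k, x; split=> // i.
by have [x_gt0 <-] := xk i; apply: cP.
Qed.
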